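(* Let $(X_t)_{t \in \mathbb{N}}$ be a random process over $\mathbb{R}$, and let $T = \inf\{t \mid X_t \leq 0\}$. Furthermore, suppose that (a) there is some value $\delta > 0$ such that, for all $t < T$, it holds that $X_t - \mathrm{E}[X_{t+1} \mid X_0, \ldots, X_t] \leq \delta$, and that (b) there is some value $c \geq 0$ such that, for all $t < T$, it holds that $\mathrm{E}\big[|X_{t+1} - X_t| \,\big|\, X_0, \ldots, X_t\big] \leq c$. Then $$\mathrm{E}[T \mid X_0] \geq \frac{X_0}{\delta}.$$
   Context: $\mathbb{N}$ includes $0$. $\inf\emptyset := \infty$, so $T$ takes values in $\mathbb{N} \cup \{\infty\}$. Conditional expectations given $X_0,\ldots,X_t$ (respectively $X_0$) are random variables, taken with respect to the $\sigma$-algebra generated by these variables; (in)equalities between random variables are understood almost surely. Since $T$ is a random variable, a requirement stated ''for all $t < T$'' means formally that, for every $t \in \mathbb{N}$, both sides of the inequality are multiplied by the indicator function of the event $\{t < T\}$; i.e., the inequality only has to hold on that event. *)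

(* Defs.v *)
From HB Require Import structures.
From mathcomp Require Import all_boot all_order all_algebra.
From mathcomp Require Import all_classical all_reals all_analysis measurable_realfun.

Set Implicit Arguments.
Unset Strict Implicit.
Unset Printing Implicit Defensive.

Import Order.TTheory GRing.Theory Num.Theory.
Import numFieldNormedType.Exports.

Local Open Scope classical_set_scope.
Local Open Scope ring_scope.
Local Open Scope ereal_scope.

Section conditional_expectation.
Context (d : measure_display) (T : measurableType d) (R : realType).
Variable P : probability T R.
Implicit Types (G : set (set T)) (Y Z : T -> \bar R).

(* Z is a version of the conditional expectation, given the sigma-algebra
   <<s G >>, of the nonnegative [0, +oo]-valued Y. No integrability is needed
   for nonnegative functions, and +oo is an allowed value of Z. *)
Definition is_condexp_ge0 G Y Z : Prop :=
  [/\ measurable_fun [set: g_sigma_algebraType G] Z,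
      forall w, 0 <= Z w &
      forall A, G.-sigma.-measurable A ->
        \int[P]_(w in A) Z w = \int[P]_(w in A) Y w].

(* An arbitrary version; existence is condexp_ge0P below. *)
Definition condexp_ge0 G Y : T -> \bar R :=
  xget (cst 0) [set Z | is_condexp_ge0 G Y Z].

(* E[Y | G] = E[Y^+ | G] - E[Y^- | G]. Where both terms are +oo, the
   conditional expectation of Y is undefined; the difference is then -oo, by
   the convention of \bar R. *)
Definition condexp G Y : T -> \bar R :=
  fun w => condexp_ge0 G Y^\+ w - condexp_ge0 G Y^\- w.

End conditional_expectation.

Section condexp_existence.
Context (d : measure_display) (T : measurableType d) (R : realType).
Variables (P : probability T R) (G : set (set T)).
Hypothesis GM : G `<=` measurable.
Local Notation GT := (g_sigma_algebraType G).

Let sGM A : G.-sigma.-measurable A -> d.-measurable A.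
Proof. exact: (smallest_sub (@sigma_algebra_measurable _ T) GM). Qed.

Let PG (A : set GT) : \bar R := P A.
Let PG0 : PG set0 = 0. Proof. exact: measure0. Qed.
Let PG_ge0 A : 0 <= PG A. Proof. exact: measure_ge0. Qed.
Let PG_sa : semi_sigma_additive PG.
Proof.
move=> F mF tF mUF; apply: (@measure_semi_sigma_additive _ _ _ P) => //.
- by move=> i; apply: sGM; exact: mF.
- exact: sGM mUF.
Qed.
HB.instance Definition _ := isMeasure.Build _ GT R PG PG0 PG_ge0 PG_sa.
Let PG1 : PG setT = 1. Proof. exact: probability_setT. Qed.
HB.instance Definition _ := Measure_isProbability.Build _ GT R PG PG1.

Let mid : measurable_fun [set: T] (id : T -> GT).
Proof. by move=> _ A mA; rewrite setTI; exact: sGM. Qed.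

Lemma sub_sigma_measurable_fun (f : T -> \bar R) :
  measurable_fun [set: GT] f -> measurable_fun [set: T] f.
Proof. by move=> mf _ B mB; apply: sGM; exact: mf. Qed.

Let int_PG (A : set T) (f : T -> \bar R) : G.-sigma.-measurable A ->
  measurable_fun [set: GT] f -> (forall w, 0 <= f w) ->
  \int[PG]_(w in A) f w = \int[P]_(w in A) f w.
Proof.
move=> mA mf f0.
rewrite (@eq_measure_integral _ GT R A (pushforward P (id : T -> GT))) //.
rewrite (@ge0_integral_pushforward _ _ T GT R id mid P A f) //.
exact: measurable_funS mf.
Qed.

Section bounded.
Variable U : T -> \bar R.
Hypotheses (mU : measurable_fun setT U) (U0 : forall w, 0 <= U w)
  (U1 : forall w, U w <= 1).

Let nu (A : set GT) : \bar R := \int[P]_(w in A) U w.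
Let nu0 : nu set0 = 0. Proof. exact: integral_set0. Qed.
Let nu_ge0 A : 0 <= nu A. Proof. exact: integral_ge0. Qed.
Let nu_sa : semi_sigma_additive nu.
Proof.
move=> F mF tF mUF; apply: (@semi_sigma_additive_nng_induced _ _ _ P U) => //.
- by move=> i; apply: sGM; exact: mF.
- exact: sGM mUF.
Qed.
HB.instance Definition _ := isMeasure.Build _ GT R nu nu0 nu_ge0 nu_sa.
Let nu_fin : fin_num_fun nu.
Proof.
move=> A mA; rewrite ge0_fin_numE//.
apply: (@le_lt_trans _ _ (\int[P]_(w in A) cst 1 w)).
  apply: ge0_le_integral => //=; first exact: sGM.
  exact: measurable_funTS.
rewrite integral_cst//=; last exact: sGM.
by rewrite mul1e (le_lt_trans (probability_le1 _ _)) ?ltry//; exact: sGM.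
Qed.
HB.instance Definition _ := Measure_isFinite.Build _ GT R nu nu_fin.

Lemma condexp_bounded_exists : exists Z, is_condexp_ge0 P G U Z.
Proof.
have nuP : nu `<< PG.
  apply/null_content_dominatesP => A mA PA0.
  apply: null_set_integral => //; first exact: sGM.
  exact: measurable_funTS.
have [Z [Z0 _ iZ ZE]] := radon_nikodym_sigma_finite nuP.
have mZ : measurable_fun [set: GT] Z by exact: (measurable_int PG).
exists Z; split => // A mA.
by rewrite -int_PG // -ZE.
Qed.
End bounded.

Lemma condexp_ge0_exists (Y : T -> \bar R) : measurable_fun setT Y ->
  (forall w, 0 <= Y w) -> exists Z, is_condexp_ge0 P G Y Z.
Proof.
move=> mY Y0.
pose v n w := fine (mine (Y w) n%:R%:E).
have vE n w : (v n w)%:E = mine (Y w) n%:R%:E.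
  rewrite /v fineK// ge0_fin_numE ?le_min ?Y0//=.
  by rewrite gt_min ltry orbT.
have vn n w : (v n w <= n%:R)%R by rewrite -lee_fin vE ge_min lexx orbT.
pose U n w := (v n.+1 w - v n w)%:E.
have mV n : measurable_fun setT (fun w => (v n w)%:E).
  under eq_fun do rewrite vE.
  exact: measurable_mine.
have mU n : measurable_fun setT (U n).
  rewrite /U; under eq_fun do rewrite EFinB.
  exact: emeasurable_funB.
have nat01 n : n%:R%:E <= n.+1%:R%:E :> \bar R by rewrite lee_fin ler_nat.
have U0 n w : 0 <= U n w.
  rewrite /U lee_fin subr_ge0 -lee_fin !vE le_min !ge_min lexx /=.
  by rewrite nat01 orbT.
have U1 n w : U n w <= 1.
  rewrite /U lee_fin lerBlDr -lee_fin EFinD !vE.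
  have [Yn|nY] := leP (Y w) n%:R%:E.
    by rewrite ge_min leeDr// lee_fin.
  by rewrite ge_min -EFinD -natr1 addrC lexx orbT.
have YE w : Y w = \sum_(n <oo) U n w.
  apply/esym/cvg_lim => //.
  have -> : (fun n => \sum_(0 <= k < n) U k w) = (fun n => mine (Y w) n%:R%:E).
    apply/funext => n; rewrite sumEFin telescope_sumr// -vE.
    have -> : v 0%N w = 0%R by rewrite /v min_r.
    by rewrite subr0.
  have := Y0 w; case: (Y w) => [r r0||//].
    apply: cvg_near_cst; near=> n; apply/min_idPl; rewrite lee_fin.
    by near: n; exact: nbhs_infty_ger.
  move=> _; under eq_fun do rewrite min_r ?leey//.
  exact/cvgeryP/cvgr_idn.
have [Z ZP] := choice (fun n => condexp_bounded_exists (mU n) (U0 n) (U1 n)).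
have mZ n : measurable_fun [set: GT] (Z n) by case: (ZP n).
have Z0 n w : 0 <= Z n w by case: (ZP n).
exists (fun w => \sum_(n <oo) Z n w); split.
- exact: (@ge0_emeasurable_sum _ GT R setT Z xpredT).
- by move=> w; exact: nneseries_ge0.
move=> A mA.
rewrite integral_nneseries//; first last.
- by move=> n; apply: measurable_funTS; exact: sub_sigma_measurable_fun.
- exact: sGM.
under [RHS]eq_integral do rewrite YE.
rewrite integral_nneseries//; first last.
- by move=> n; exact: measurable_funTS.
- exact: sGM.
by apply: eq_eseriesr => n _; case: (ZP n) => _ _; exact.
Unshelve. all: by end_near. Qed.

Lemma condexp_ge0P (Y : T -> \bar R) : measurable_fun setT Y ->
  (forall w, 0 <= Y w) -> is_condexp_ge0 P G Y (condexp_ge0 P G Y).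
Proof.
move=> mY Y0; rewrite /condexp_ge0.
case: xgetP => [Z -> //|nZ]; have [Z /nZ] := condexp_ge0_exists mY Y0.
by [].
Qed.

End condexp_existence.

(* inf {t | X_t <= 0}; ereal_inf set0 = +oo. *)
Definition hitting_time (T : Type) (R : realType) (X : nat -> T -> R) (w : T) :
  \bar R := ereal_inf [set t%:R%:E | t in [set t | (X t w <= 0)%R]].

(* The sigma-algebra generated by X_0, ..., X_t. *)
Definition history (T : Type) (R : realType) (X : nat -> T -> R) (t : nat) :
  set (set T) := g_sigma_preimage (fun i : 'I_t.+1 => X i).

(* Main.v *)
From HB Require Import structures.
From mathcomp Require Import all_boot all_order all_algebra.
From mathcomp Require Import all_classical all_reals all_analysis measurable_realfun.
From mathcomp Require Import lra zify.
Require Import Defs.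

Set Implicit Arguments.
Unset Strict Implicit.
Unset Printing Implicit Defensive.

Import Order.TTheory GRing.Theory Num.Theory.
Import numFieldNormedType.Exports.

Local Open Scope classical_set_scope.
Local Open Scope ring_scope.
Local Open Scope ereal_scope.

(** Stop the process when it leaves the positive half-line. While it is alive,
    each step costs at most delta in conditional mean, so on an event A of the
    sigma-algebra of X_0, with B_t the part of A on which t < T and
    a_t = E[X_t; B_t], the drift condition gives

      a_t <= delta * P(B_t) + a_(t+1).

    Here X_(t+1) is integrated over B_(t+1) rather than B_t, which only drops
    nonpositive values. Summing, and using that the indicators of t < T add up
    to at most T, gives a_0 <= delta * E[T; A] + a_k for every k. This is
    optional stopping with nonnegative integrands only, so that every integral
    makes sense in [0, +oo].

    It remains to see that a_k tends to 0 when E[T; A] is finite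
    ([survival_integral_cvg0]). The probabilities P(B_t) are then summable, so
    Borel-Cantelli makes X_k restricted to B_k vanish eventually, almost surely.
    On an event A where X_0 is bounded by K, X_k on B_k is at most K plus the
    sum of all jumps made while alive, and the expectation of that sum is at
    most c times the sum of the P(B_t), by the bound on the expected jumps: it
    is a dominating function.

    This proves E[X_0; A and 0 < T] <= delta * E[T; A] for all such A
    ([integral_start_le_hitting_time]). Since events on which X_0 is bounded
    are enough to compare a conditional expectation with a function of X_0
    ([le_condexp_ge0]), the pointwise bound follows, even if X_0 has
    infinite mean. *)

(** * Conditional expectations of nonnegative functions *)

Section nonneg_condexp.
Context (d : measure_display) (T : measurableType d) (R : realType).
Variables (P : probability T R) (G : set (set T)).
Hypothesis GM : G `<=` measurable.
Local Notation GT := (g_sigma_algebraType G).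

Lemma sub_sigma_measurable A : G.-sigma.-measurable A -> d.-measurable A.
Proof. exact: (smallest_sub (@sigma_algebra_measurable _ T) GM). Qed.

(** The negative part of Y is zero, but [condexp] subtracts an arbitrary version
    of its conditional expectation, which vanishes only almost everywhere. *)
Lemma condexp_of_ge0 (Y : T -> \bar R) : (forall w, 0 <= Y w) ->
  {ae P, forall w, condexp P G Y w = condexp_ge0 P G Y w}.
Proof.
move=> Y0.
have -> : Y = Y^\+ by apply/funext => w; rewrite (@ge0_funeposE _ _ setT)// inE.
have YN : Y^\- = cst 0.
  by apply/funext => w; rewrite (@ge0_funenegE _ _ setT)// inE.
have [mZ Z0 iZ] : is_condexp_ge0 P G (cst 0) (condexp_ge0 P G (cst 0)).
  by apply: condexp_ge0P.
have : \int[P]_(w in setT) `|condexp_ge0 P G (cst 0) w| = 0.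
  have -> : (fun w => `|condexp_ge0 P G (cst 0) w|) = condexp_ge0 P G (cst 0).
    by apply/funext => w; rewrite gee0_abs.
  by rewrite (iZ _ (@measurableT _ GT)); exact: integral0.
move/(ae_eq_integral_abs P measurableT (sub_sigma_measurable_fun GM mZ)).
apply: filterS => w /(_ I) Zw.
rewrite /condexp (_ : (Y^\+)^\+ = Y^\+); last first.
  by apply/funext => x; rewrite (@ge0_funeposE _ _ setT)// inE.
rewrite (_ : (Y^\+)^\- = cst 0) ?Zw ?sube0//.
by apply/funext => x; rewrite (@ge0_funenegE _ _ setT)// inE.
Qed.

(** Testing on events where V is bounded suffices: the event where V exceeds the
    conditional expectation is the union over n of its parts on which V <= n,
    and on each of them both integrals are finite, so that they can be
    subtracted. *)
Lemma le_condexp_ge0 (Y : T -> \bar R) (V : T -> R) :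
  measurable_fun setT Y -> (forall w, 0 <= Y w) ->
  measurable_fun [set: GT] V -> (forall w, 0 <= V w)%R ->
  (forall A n, G.-sigma.-measurable A -> (forall w, A w -> V w <= n%:R)%R ->
    \int[P]_(w in A) (V w)%:E <= \int[P]_(w in A) Y w) ->
  {ae P, forall w, (V w)%:E <= condexp_ge0 P G Y w}.
Proof.
move=> mY Y0 mV V0 VY; set Z := condexp_ge0 P G Y.
have [mZ Z0 iZ] : is_condexp_ge0 P G Y Z by exact: condexp_ge0P.
pose A n := [set w | Z w < (V w)%:E] `&` [set w | V w <= n%:R]%R.
have mEV : measurable_fun [set: GT] (EFin \o V) by exact: measurableT_comp.
have GA n : G.-sigma.-measurable (A n).
  apply: measurableI.
    rewrite -[X in measurable X]setTI.
    exact: (@measurable_lte _ GT R setT (@measurableT _ GT) Z (EFin \o V)).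
  rewrite -[X in measurable X]setTI.
  exact: (@measurable_fun_le _ GT R setT V (cst n%:R)).
have mA n : measurable (A n) by exact: sub_sigma_measurable.
have TmZ : measurable_fun setT Z by exact: sub_sigma_measurable_fun mZ.
have TmV : measurable_fun setT (EFin \o V).
  exact: sub_sigma_measurable_fun mEV.
have PA n : P (A n) = 0.
  pose h w := (V w)%:E - Z w.
  have mh : measurable_fun (A n) h.
    by apply: emeasurable_funB; exact: measurable_funTS.
  have h0 w : A n w -> 0 < h w by move=> [/= ? _]; rewrite /h sube_gt0.
  have Vh w : A n w -> (V w)%:E = Z w + h w.
    move=> [/= ZV _]; rewrite /h addeC subeK//.
    by rewrite ge0_fin_numE// (lt_trans ZV) ?ltry.
  have iVh : \int[P]_(w in A n) (V w)%:E =
      \int[P]_(w in A n) Z w + \int[P]_(w in A n) h w.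
    under eq_integral => w /[!inE] Aw do rewrite (Vh _ Aw).
    rewrite ge0_integralD//; first exact: measurable_funTS.
    by move=> w /h0/ltW.
  have Vfin : \int[P]_(w in A n) (V w)%:E < +oo.
    apply: (@le_lt_trans _ _ (\int[P]_(w in A n) cst n%:R%:E w)).
      apply: ge0_le_integral => //=.
      - by move=> w _; rewrite lee_fin.
      - exact: measurable_funTS.
      - by move=> w [_ /=]; rewrite lee_fin.
    rewrite integral_cst// lte_mul_pinfty// ?lee_fin//.
    by rewrite (le_lt_trans (probability_le1 _ _)) ?ltry.
  have Zfin : \int[P]_(w in A n) Z w \is a fin_num.
    rewrite ge0_fin_numE; last exact: integral_ge0.
    apply: le_lt_trans Vfin; rewrite iVh leeDl//.
    by apply: integral_ge0 => w /h0/ltW.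
  have ih0 : \int[P]_(w in A n) `|h w| = 0.
    under eq_integral => w /[!inE] /h0/ltW Aw do rewrite gee0_abs//.
    apply/eqP; rewrite eq_le; apply/andP; split; last first.
      by apply: integral_ge0 => w /h0/ltW.
    have : \int[P]_(w in A n) (V w)%:E <= \int[P]_(w in A n) Z w.
      by rewrite iZ//; apply: (VY _ n) => // w [].
    by rewrite iVh -[leRHS]adde0 leeD2lE.
  have /(ae_eq_integral_abs P (mA n) mh) := ih0.
  move=> [N [mN PN hN]]; apply: (subset_measure0 (mA n) mN) => // w Aw.
  by apply: hN => /= /(_ Aw) h0w; have := h0 _ Aw; rewrite h0w ltxx.
have : P.-negligible (\bigcup_n A n).
  by apply: negligible_bigcup => n; apply/(negligibleP _ (mA n)); exact: PA.
move=> [N [mN PN AN]]; exists N; split => // w /= /negP; rewrite -ltNge => ZV.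
apply: AN.
exists (Num.bound (V w)) => //; split => //=.
by apply: ltW; exact: archi_boundP.
Qed.

Lemma integral_condexp_step (Y : T -> \bar R) (B : set T) (c : R) :
  measurable_fun setT Y -> (forall w, 0 <= Y w) -> (0 <= c)%R ->
  G.-sigma.-measurable B ->
  {ae P, forall w, B w -> condexp P G Y w <= c%:E} ->
  \int[P]_(w in B) Y w <= c%:E * P B.
Proof.
move=> mY Y0 c0 GB YB.
have mB := sub_sigma_measurable GB.
have [mZ Z0 iZ] := condexp_ge0P P GM mY Y0.
rewrite -iZ// -integral_cst//; apply: ae_ge0_le_integral => //.
- by apply: measurable_funTS; exact: sub_sigma_measurable_fun mZ.
- by move: YB (condexp_of_ge0 Y0); apply: filterS2 => w + <-.
Qed.

(** Only the positive part of y enters: the conditional expectation of its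
    negative part, which may be infinite, is simply bounded below by 0, and all
    remaining integrands are nonnegative. *)
Lemma integral_condexp_drift (x y : T -> R) (B : set T) (delta : R) :
  measurable_fun setT x -> measurable_fun setT y -> (0 <= delta)%R ->
  G.-sigma.-measurable B -> (forall w, B w -> 0 <= x w)%R ->
  {ae P, forall w, B w ->
    (x w)%:E - condexp P G (fun w => (y w)%:E) w <= delta%:E} ->
  \int[P]_(w in B) (x w)%:E <=
    delta%:E * P B + \int[P]_(w in B `&` [set w | 0 < y w]%R) (y w)%:E.
Proof.
move=> mx my d0 GB x0 xy.
have mB := sub_sigma_measurable GB.
pose Y := (fun w => (y w)%:E) : T -> \bar R.
have mY : measurable_fun setT Y by exact: measurableT_comp.
have mYp : measurable_fun setT Y^\+ by exact: measurable_funepos.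
have mYn : measurable_fun setT Y^\- by exact: measurable_funeneg.
have [mZ Z0 iZ] := condexp_ge0P P GM mYp (funepos_ge0 _).
have [_ Z'0 _] := condexp_ge0P P GM mYn (funeneg_ge0 _).
have TmZ := sub_sigma_measurable_fun GM mZ.
apply: (@le_trans _ _ (\int[P]_(w in B) (delta%:E + condexp_ge0 P G Y^\+ w))).
  apply: ae_ge0_le_integral => //.
  - by apply: measurable_funTS; exact: measurableT_comp.
  - by move=> w _; rewrite adde_ge0.
  - by apply: emeasurable_funD => //; exact: measurable_funTS.
  (* Where the first conditional expectation is infinite the bound is trivial;
     where only the second one is, their difference is -oo and the hypothesis
     fails. *)
  apply: filterS xy => w + Bw => /(_ Bw); rewrite /condexp -/Y.
  move: (Z0 w) (Z'0 w).
  case: (condexp_ge0 P G Y^\+ w) => [a||];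
    case: (condexp_ge0 P G Y^\- w) => [b||];
    rewrite ?leey//= => a0 b0.
  by rewrite !lee_fin in b0 *; lra.
rewrite ge0_integralD//; last exact: measurable_funTS.
rewrite integral_cst// leeD2l// iZ//.
rewrite integral_mkcondr le_eqVlt; apply/orP; left; apply/eqP.
apply: eq_integral => w _; rewrite /patch funeposE /Y.
case: ifPn => [/set_mem/= yw|/negP yw].
  by apply/max_idPl; rewrite lee_fin ltW.
apply/max_idPr; rewrite lee_fin leNgt; apply/negP => y0.
by apply: yw; rewrite inE.
Qed.

End nonneg_condexp.

(** * The hitting time and the events t < T *)

Definition alive (T : Type) (R : realType) (X : nat -> T -> R) (t : nat) :
  set T := [set w | (t%:R%:E : \bar R) < hitting_time X w].

Section hitting_time.
Context (d : measure_display) (T : measurableType d) (R : realType).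
Variable X : nat -> T -> R.

Lemma aliveP t w :
  alive X t w <-> (forall s, (s <= t)%N -> 0 < X s w)%R.
Proof.
split=> [/= tT s st|X0].
 
  rewrite ltNge; apply/negP => Xs; move: tT; apply/negP; rewrite -leNgt.
  apply: (@le_trans _ _ s%:R%:E); last by rewrite lee_fin ler_nat.
  by apply: ereal_inf_lbound; exists s.
apply: (@lt_le_trans _ _ t.+1%:R%:E); first by rewrite lte_fin ltr_nat.
apply: le_ereal_inf_tmp => _ [s /= Xs <-]; rewrite lee_fin ler_nat ltnNge.
by apply: contraTN Xs => /X0; rewrite -ltNge.
Qed.

Lemma hitting_time_ge0 w : 0 <= hitting_time X w.
Proof. by apply: le_ereal_inf_tmp => _ [s _ <-]; rewrite lee_fin. Qed.

(** The sum is min(n, T). *)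
Lemma sum_indic_alive n w :
  \sum_(0 <= t < n) (\1_(alive X t) w : R)%:E
    <= hitting_time X w :> \bar R.
Proof.
apply: le_ereal_inf_tmp => _ [s Xs <-].
suff H t : ((\1_(alive X t) w : R) <= (t < s)%N%:R)%R.
  apply: (@le_trans _ _ (\sum_(0 <= t < n) ((t < s)%N%:R : R)%:E)).
    by apply: lee_sum => t _; rewrite lee_fin.
  rewrite sumEFin lee_fin -natr_sum ler_nat.
  suff: (\sum_(0 <= t < n) (t < s) <= minn n s)%N.
    by move=> /leq_trans; apply; exact: geq_minr.
  elim: n => [|n IHn]; first by rewrite big_geq.
  rewrite big_nat_recr//= (leq_trans (leq_add IHn (leqnn _)))//.
  by case: (ltnP n s) => /= ?; lia.
rewrite indicE ler_nat; case: ltnP => [_|st]; first exact: leq_b1.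
rewrite memNset// => /aliveP/(_ _ st).
by rewrite ltNge Xs.
Qed.

Hypothesis mX : forall t, measurable_fun setT (X t).

Lemma measurable_hitting_time : measurable_fun setT (hitting_time X).
Proof.
(* T is the infimum of the functions equal to t where X_t <= 0, else +oo. *)
pose h t w : \bar R := if (X t w <= 0)%R then t%:R%:E else +oo.
have -> : hitting_time X = (fun w => einfs (h ^~ w) 0%N).
  apply/funext => w; apply/eqP; rewrite eq_le; apply/andP; split.
    apply: le_ereal_inf_tmp => _ [t _ <-]; rewrite /h; case: ifPn => Xt.
      by apply: ereal_inf_lbound; exists t.
    by rewrite leey.
  apply: le_ereal_inf_tmp => _ [t Xt <-]; apply: ereal_inf_lbound.
  by exists t => //; rewrite /h Xt.
apply: measurable_fun_einfs => t; apply: measurable_fun_ifT => //.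
exact: measurable_fun_ler.
Qed.

Lemma history_measurable t : history X t `<=` measurable.
Proof.
apply: smallest_sub; first exact: sigma_algebra_measurable.
rewrite -bigcup_mkord_ord => A [i /= it [B mB <-]]; exact: mX.
Qed.

Lemma measurable_history s t : (s <= t)%N ->
  measurable_fun [set: g_sigma_algebraType (history X t)] (X s).
Proof.
move=> st _ B mB; apply: sub_sigma_algebra; apply: sub_sigma_algebra.
rewrite -bigcup_mkord_ord; exists s => //=.
by exists B => //; rewrite inordK.
Qed.

Lemma history_measurable_alive t : (history X t).-sigma.-measurable
  (alive X t).
Proof.
have -> : alive X t =
    \bigcap_(s in [set s | s <= t]%N) [set w | 0 < X s w]%R.
  by apply/seteqP; split => w /= /aliveP.
apply: (@bigcap_measurable _ (g_sigma_algebraType (history X t))).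
  by exists 0%N.
move=> s /= st; rewrite -[X in measurable X]setTI.
pose HT := g_sigma_algebraType (history X t).
have mlt : measurable_fun [set: HT] (fun w => 0 < X s w)%R.
  apply: measurable_fun_ltr; first exact: measurable_cst.
  exact: measurable_history.
by have := mlt measurableT [set true] I; rewrite preimage_true.
Qed.

Lemma sub_history0 t A :
  (g_sigma_algebra_preimage (X 0)).-sigma.-measurable A ->
  (history X t).-sigma.-measurable A.
Proof.
apply: smallest_sub.
  exact: (@sigma_algebra_measurable _ (g_sigma_algebraType (history X t))).
by move=> _ [B mB <-]; apply: measurable_history.
Qed.

End hitting_time.

(** * Vanishing of the surviving mass *)

Section survival.
Context (d : measure_display) (T : measurableType d) (R : realType).
Variables (P : probability T R) (X : nat -> T -> R) (B : nat -> set T) (K : R).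
Hypotheses (mX : forall t, measurable_fun setT (X t))
  (mB : forall t, measurable (B t))
  (decrB : forall s t, (s <= t)%N -> B t `<=` B s)
  (X_ge0 : forall t w, B t w -> (0 <= X t w)%R)
  (X0_le : forall w, B 0%N w -> (X 0%N w <= K)%R).

(** Dominated convergence for X_t restricted to B_t: the limit is 0 almost
    surely by Borel-Cantelli, and the dominating function is K plus the sum of
    all jumps |X_(t+1) - X_t| made on B_t. *)
Lemma survival_integral_cvg0 : (0 <= K)%R ->
  \sum_(t <oo) P (B t) < +oo ->
  \sum_(t <oo) \int[P]_(w in B t) `|X t.+1 w - X t w|%:E < +oo ->
  \int[P]_(w in B t) (X t w)%:E @[t --> \oo] --> 0.
Proof.
move=> K0 sumPB sumD.
pose D t w : \bar R := `|X t.+1 w - X t w|%:E.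
have mD t : measurable_fun setT (D t).
  do 2 apply: measurableT_comp => //.
  exact: measurable_funB.
have mDB t : measurable_fun setT (D t \_ (B t)).
  by apply/(measurable_restrictT _ (mB t)); exact: measurable_funTS.
have DB_ge0 t w : 0 <= (D t \_ (B t)) w.
  by apply: erestrict_ge0 => ? _; rewrite lee_fin.
pose g w := K%:E + \sum_(t <oo) (D t \_ (B t)) w.
have mg : measurable_fun setT g.
  by apply: emeasurable_funD => //; exact: (ge0_emeasurable_sum (P := xpredT)).
have g_ge0 w : 0 <= g w.
  by rewrite adde_ge0 ?lee_fin//; exact: nneseries_ge0.
have ig : P.-integrable setT g.
  apply/integrableP; split => //.
  under eq_integral do rewrite gee0_abs//.
  rewrite ge0_integralD//; last 2 first.
  - by move=> w _; exact: nneseries_ge0.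
  - exact: (ge0_emeasurable_sum (P := xpredT)).
  rewrite integral_cst// integral_nneseries// lte_add_pinfty//.
    rewrite lte_mul_pinfty ?lee_fin//.
    by rewrite (le_lt_trans (probability_le1 _ _)) ?ltry.
  by under eq_eseriesr do rewrite -integral_mkcond.
pose f t := (EFin \o X t) \_ (B t).
have mf t : measurable_fun setT (f t).
  apply/(measurable_restrictT _ (mB t)); apply: measurable_funTS.
  exact: measurableT_comp.
have fg t w : `|f t w| <= g w.
  rewrite /f patchE; case: ifPn => [/set_mem Bt|_]; last by rewrite abse0.
  rewrite /= ger0_norm ?X_ge0//.
  (* As B decreases, w is in B_s for all s < t: every jump up to t counts. *)
  have -> : X t w = (X 0%N w + \sum_(0 <= s < t) (X s.+1 w - X s w))%R.
    by rewrite telescope_sumr// addrC subrK.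
  rewrite EFinD; apply: leeD; first by rewrite lee_fin X0_le//; exact: decrB Bt.
  apply: le_trans (nneseries_lim_ge t (fun s _ _ => DB_ge0 s w)).
  rewrite -sumEFin big_nat_cond [leRHS]big_nat_cond.
  apply: lee_sum => s /andP[/andP[_ st] _].
  rewrite patchE mem_set ?lee_fin ?ler_norm//.
  by apply: decrB Bt; exact: ltnW.
have f0 : {ae P, forall w, setT w -> f t w @[t --> \oo] --> 0}.
  have := lim_sup_set_cvg0 mB sumPB.
  have mlim : measurable (lim_sup_set B).
    by apply: bigcapT_measurable => n; apply: bigcup_measurable.
  move=> Plim; exists (lim_sup_set B); split => // w /= nf0 n _.
  apply: contrapT => nB; apply: nf0 => _.
  apply: cvg_near_cst; exists n => // t /= nt.
  rewrite /f patchE memNset// => Bt; apply: nB; by exists t.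
have [_ _] := dominated_convergence measurableT mf (measurable_cst 0) f0 ig
  (aeW _ (fun w t _ => fg t w)).
rewrite integral0; apply: cvg_trans; apply: near_eq_cvg; near=> t.
by rewrite /= /f -integral_mkcond.
Unshelve. all: by end_near. Qed.

End survival.

(** * The lower bound under additive drift *)

Section additive_drift.
Context (d : measure_display) (T : measurableType d) (R : realType).
Variables (P : probability T R) (X : nat -> T -> R) (delta c : R).
Hypotheses (mX : forall t, measurable_fun setT (X t))
  (delta_gt0 : (0 < delta)%R) (c_ge0 : (0 <= c)%R)
  (drift : forall t, {ae P, forall w, t%:R%:E < hitting_time X w ->
     (X t w)%:E - condexp P (history X t) (fun w => (X t.+1 w)%:E) w
       <= delta%:E})
  (step : forall t, {ae P, forall w, t%:R%:E < hitting_time X w ->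
     condexp P (history X t) (fun w => `|X t.+1 w - X t w|%:E) w <= c%:E}).

(** The integrated form of the theorem. The bound K on X_0 gives the dominating
    function of [survival_integral_cvg0] a finite mean. *)
Lemma integral_start_le_hitting_time (A : set T) (K : R) : (0 <= K)%R ->
  (g_sigma_algebra_preimage (X 0%N)).-sigma.-measurable A ->
  (forall w, A w -> X 0%N w <= K)%R ->
  \int[P]_(w in A `&` alive X 0) (X 0%N w)%:E
    <= delta%:E * \int[P]_(w in A) hitting_time X w.
Proof.
move=> K0 sA AK; pose B t : set T := A `&` alive X t.
have sB t : (history X t).-sigma.-measurable (B t).
  by apply: measurableI; [exact: sub_history0|exact: history_measurable_alive].
have hM t := history_measurable mX (t := t).
have mB t : measurable (B t) := sub_sigma_measurable (hM t) (sB t).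
have mA : measurable A.
  exact: (sub_sigma_measurable (hM 0%N) (sub_history0 sA)).
have X_gt0 t w : B t w -> (0 < X t w)%R by move=> [_ /aliveP]; exact.
have X_ge0 t w : B t w -> (0 <= X t w)%R by move=> /X_gt0/ltW.
have decrB s t : (s <= t)%N -> B t `<=` B s.
  move=> st w [Aw /aliveP Xw]; split => //; apply/aliveP => r rs.
  exact: Xw (leq_trans rs st).
have mL t : measurable (alive X t).
  exact: (sub_sigma_measurable (hM t) (history_measurable_alive (t:=t))).
have mI t : measurable_fun A (fun w => (\1_(alive X t) w : R)%:E).
  by apply: measurable_funTS; apply: measurableT_comp.
have mT := measurable_hitting_time mX.
pose a t := \int[P]_(w in B t) (X t w)%:E.
pose S k := \sum_(0 <= t < k) P (B t).
have SE k : S k <= \int[P]_(w in A) hitting_time X w.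
  have -> : S k =
      \int[P]_(w in A) \sum_(0 <= t < k) (\1_(alive X t) w : R)%:E.
    rewrite ge0_integral_sum//.
    apply: eq_bigr => t _; rewrite /B setIC.
    by symmetry; apply: (integral_indic P mA (mL t)).
  apply: ge0_le_integral => //.
  - by move=> w _; apply: sume_ge0 => t _; rewrite lee_fin.
  - exact: emeasurable_sum.
  - exact: measurable_funTS.
  - by move=> w _; exact: sum_indic_alive.
(* Restricting from B_t to the event X_(t+1) > 0 yields exactly B_(t+1). *)
have aS t : a t <= delta%:E * P (B t) + a t.+1.
  have -> : a t.+1 =
      \int[P]_(w in B t `&` [set w | 0 < X t.+1 w]%R) (X t.+1 w)%:E.
    congr (integral _ _ _); apply/seteqP; split => w /=.
      by move=> Bw; split; [exact: decrB Bw|exact: X_gt0].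
    move=> [[Aw /aliveP Xw] Xt]; split => //; apply/aliveP => s.
    by rewrite leq_eqVlt => /predU1P[->//|]; exact: Xw.
  apply: (integral_condexp_drift (hM t)) => //; first exact: ltW.
    exact: X_ge0.
  by apply: filterS (drift t) => w Xw [_]; exact: Xw.
have aSn k : a 0%N <= delta%:E * S k + a k.
  elim: k => [|k /le_trans]; first by rewrite /S big_geq// mule0 add0e.
  apply; rewrite /S big_nat_recr//= ge0_muleDr//; last exact: sume_ge0.
  by rewrite -addeA leeD2l.
have [Tfin|] := ltP (\int[P]_(w in A) hitting_time X w) +oo; last first.
  by rewrite leye_eq => /eqP ->; rewrite gt0_muley ?lte_fin// leey.
have sumPB : \sum_(t <oo) P (B t) < +oo.
  apply: le_lt_trans Tfin; apply: lime_le; first exact: is_cvg_nneseries.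
  by apply: nearW => k; exact: SE.
have DB t : \int[P]_(w in B t) `|X t.+1 w - X t w|%:E <= c%:E * P (B t).
  apply: (integral_condexp_step (hM t)) => //.
  - by do 2 apply: measurableT_comp => //; exact: measurable_funB.
  - by apply: filterS (step t) => w Xw [_]; exact: Xw.
have sumD : \sum_(t <oo) \int[P]_(w in B t) `|X t.+1 w - X t w|%:E < +oo.
  apply: (@le_lt_trans _ _ (\sum_(t <oo) c%:E * P (B t))).
    apply: lee_nneseries => // t _ _.
    by apply: integral_ge0 => w _; rewrite lee_fin.
  rewrite nneseriesZl//; last by rewrite lte_mul_pinfty// lee_fin.
have a0 : a t @[t --> \oo] --> 0.
  apply: (@survival_integral_cvg0 _ _ _ P X B K) => //.
  by move=> w [/AK].
have da0 : (delta%:E * \int[P]_(w in A) hitting_time X w + a t) @[t --> \oo] -->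
    delta%:E * \int[P]_(w in A) hitting_time X w + 0.
  apply: cvgeD => //; first exact: fin_num_adde_defl.
  exact: cvg_cst.
rewrite adde0 in da0; rewrite -(cvg_lim _ da0)//.
apply: lime_ge; first by apply/cvg_ex; eexists; exact: da0.
apply: nearW => k; apply: le_trans (aSn k) _; apply: leeD => //.
by rewrite lee_wpmul2l// lee_fin ltW.
Qed.

(** The comparison is made with the positive part of X_0: [le_condexp_ge0] asks
    for a nonnegative function, and T = 0 where X_0 <= 0. *)
Lemma hitting_time_drift_lower_bound :
  {ae P, forall w, (X 0%N w / delta)%:E <=
    condexp P (g_sigma_algebra_preimage (X 0%N)) (hitting_time X) w}.
Proof.
set G := g_sigma_algebra_preimage (X 0%N).
have GM : G `<=` measurable.
  by move=> _ [B mB <-]; exact: mX.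
have mX0 : measurable_fun [set: g_sigma_algebraType G] (X 0%N).
  by move=> _ B mB; apply: sub_sigma_algebra; exists B.
have T_ge0 := hitting_time_ge0 X.
pose V w : R := (Num.max (X 0%N w) 0 / delta)%R.
have mV : measurable_fun [set: g_sigma_algebraType G] V.
  apply: measurable_funM; last exact: measurable_cst.
  by apply: measurable_maxr; [exact: mX0|exact: measurable_cst].
have V_ge0 w : (0 <= V w)%R.
  by rewrite divr_ge0 ?le_max ?lexx ?orbT// ltW.
have VT (A : set T) (n : nat) : G.-sigma.-measurable A ->
    (forall w, A w -> V w <= n%:R)%R ->
    \int[P]_(w in A) (V w)%:E <= \int[P]_(w in A) hitting_time X w.
  move=> sA An; have mA := sub_sigma_measurable GM sA.
  rewrite -(@lee_pmul2l _ delta%:E) ?lte_fin// -ge0_integralZl//; last 3 first.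
  - apply: measurable_funTS; apply: (sub_sigma_measurable_fun GM).
    exact: measurableT_comp.
  - by move=> w _; rewrite lee_fin.
  - by rewrite lee_fin ltW.
  have -> : \int[P]_(w in A) (delta%:E * (V w)%:E) =
      \int[P]_(w in A `&` alive X 0) (X 0%N w)%:E.
    rewrite integral_mkcondr; apply: eq_integral => w _.
    rewrite -EFinM /V mulrC divfK ?gt_eqF// patchE.
    case: ifPn => [/set_mem/aliveP/(_ 0%N isT)/ltW X0|/negP X0].
      by congr EFin; apply/max_idPl.
    congr EFin; apply/max_idPr; rewrite leNgt; apply/negP => X0_gt0.
    by apply: X0; rewrite inE; apply/aliveP => -[].
  apply: (@integral_start_le_hitting_time A (delta * n%:R)) => //.
    by rewrite mulr_ge0// ltW.
  move=> w /An; rewrite /V ler_pdivrMr// mulrC; apply: le_trans.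
  by rewrite le_max lexx.
have mT := measurable_hitting_time mX.
move: (condexp_of_ge0 P GM T_ge0) (le_condexp_ge0 GM mT T_ge0 mV V_ge0 VT).
apply: filterS2 => w ->; apply: le_trans.
by rewrite lee_fin ler_pM2r ?invr_gt0// le_max lexx.
Qed.

End additive_drift.

Theorem theorem7 (d : measure_display) (Omega : measurableType d)
    (R : realType) (P : probability Omega R) (X : nat -> {RV P >-> R})
    (delta c : R) (delta_gt0 : (0 < delta)%R) (c_ge0 : (0 <= c)%R)
    (drift : forall t : nat, {ae P, forall w,
       t%:R%:E < hitting_time X w ->
       (X t w)%:E - condexp P (history X t) (fun w => (X t.+1 w)%:E) w
         <= delta%:E})
    (step : forall t : nat, {ae P, forall w,
       t%:R%:E < hitting_time X w ->
       condexp P (history X t) (fun w => `|X t.+1 w - X t w|%:E) w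
         <= c%:E}) :
  {ae P, forall w,
     (X 0%N w / delta)%:E <=
     condexp P (g_sigma_algebra_preimage (X 0%N)) (hitting_time X) w}.
Proof.
exact: (hitting_time_drift_lower_bound (fun t => @measurable_funPT _ _ _ _ (X t))
  delta_gt0 c_ge0 drift step).
Qed.
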